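(* For $n\ge 0$ let $a_n:=P(\overline{(\sigma_1\sigma_2)^n\sigma_1};y,z)$, where $\sigma_1,\sigma_2\in B_3$. Then for every $n\geq0$, $$a_{n+4}-(y^{-2}z^2-y^{-2})a_{n+3}+y^{-4}z^2a_{n+2}-(y^{-6}z^2-y^{-6})a_{n+1}+y^{-8}a_n=0.$$
   Context: A crossing of an oriented link diagram in the oriented plane is positive if the ordered pair (tangent vector of the overpassing arc, tangent vector of the underpassing arc) agrees with the orientation of the plane, and negative otherwise. $B_3$ denotes the braid group on $3$ strands with Artin generators $\sigma_1,\sigma_2$, where $\sigma_i$ is the elementary braid in which the $i$th and $(i+1)$st strands form a positive crossing (all strands oriented in the same direction along the braid). $\overline{x}$ denotes the closure of a braid $x$, an oriented link. The HOMFLY polynomial $P(L;y,z)\in\mathbb{Z}[y^{\pm1},z^{\pm1}]$ of an oriented link $L$ is the unique oriented link invariant, computed from any diagram, with $P(\text{unknot};y,z)=1$ and $yP(D_+;y,z)+y^{-1}P(D_-;y,z)=zP(D_0;y,z)$ for every skein triple $(D_+,D_-,D_0)$, i.e. three oriented diagrams identical except near one crossing, where the crossing is respectively positive, negative, and smoothed (orientation-consistently). *)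

(* Defs.v *)
From mathcomp Require Import all_boot all_order all_algebra.

Set Implicit Arguments.
Unset Strict Implicit.
Unset Printing Implicit Defensive.

Import Order.TTheory GRing.Theory Num.Theory.
Local Open Scope ring_scope.

(* ** Oriented link diagrams

   A diagram in the oriented plane, in general position with respect to the
   height function, is read from bottom to top as a sequence of slices, each
   containing a single minimum, maximum or crossing. A slice (i, p) consists of
   the piece p with i vertical strands to its left, and vertical strands to its
   right. Strands are numbered from 0, from left to right. *)

(* Orientation of a strand crossing a horizontal level: true = upwards. *)
Definition direction := bool.

(* - Cup d: a local minimum; its left end has direction d, its right end the
     opposite direction;
   - Cap: a local maximum;
   - Cross b: a crossing of a strand "/" running from bottom left to top right
     with a strand "\" running from bottom right to top left; the strand "/" is
     the overpassing one iff b = true. *)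
Inductive piece := Cup of direction | Cap | Cross of bool.

Definition slice := (nat * piece)%type.

Definition piece_in (p : piece) : nat := if p is Cup _ then 0 else 2.
Definition piece_out (p : piece) : nat := if p is Cap then 0 else 2.

(* [step s x] is the sequence of directions of the strands just above the slice
   x, given the directions s of the strands just below it; it is None if x does
   not fit on s, in particular if a maximum joins two strands whose directions
   do not match. *)
Definition step (s : seq direction) (x : slice) : option (seq direction) :=
  let: (i, p) := x in
  match p with
  | Cup d => if (i <= size s)%N
             then Some (take i s ++ [:: d, ~~ d & drop i s]) else None
  | Cap => if drop i s is a :: c :: t
           then if a == ~~ c then Some (take i s ++ t) else None
           else None
  | Cross _ => if drop i s is a :: c :: t
               then Some (take i s ++ [:: c, a & t]) else None
  end.

Fixpoint run (s : seq direction) (u : seq slice) : option (seq direction) :=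
  if u is x :: v then obind (run^~ v) (step s x) else Some s.

(* The empty diagram is excluded: links have at least one component. *)
Record diagram := Diagram {
  slices :> seq slice;
  diagram_nonempty : (0 < size slices)%N;
  diagram_closed : run [::] slices = Some [::] }.

(* ** Isotopy *)

(* Local moves between slice sequences. The first five are planar isotopies
   (exchange of the heights of two distant pieces, cancellation of a minimum
   with an adjacent maximum, passing a strand transverse to an arc over the
   extremum of that arc); the others are the Reidemeister moves. In the third
   Reidemeister move with crossings b, b', b'' the three strands lie at
   three different heights iff b' equals b or b''. Orientations are carried
   along by the cups. *)
Inductive local_move : seq slice -> seq slice -> Prop :=
| move_exchange i k p q :
    local_move [:: (i, p); (i + piece_out p + k, q)%N]
               [:: (i + piece_in p + k, q)%N; (i, p)]
| move_zigzag_left i d : local_move [:: (i.+1, Cup d); (i, Cap)] [::]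
| move_zigzag_right i d : local_move [:: (i, Cup d); (i.+1, Cap)] [::]
| move_cap_slide i b :
    local_move [:: (i, Cross b); (i.+1, Cap)]
               [:: (i.+1, Cross (~~ b)); (i, Cap)]
| move_cup_slide i b d :
    local_move [:: (i.+1, Cup d); (i, Cross b)]
               [:: (i, Cup d); (i.+1, Cross (~~ b))]
| move_R1_cap i b : local_move [:: (i, Cross b); (i, Cap)] [:: (i, Cap)]
| move_R1_cup i b d :
    local_move [:: (i, Cup d); (i, Cross b)] [:: (i, Cup (~~ d))]
| move_R2 i b : local_move [:: (i, Cross b); (i, Cross (~~ b))] [::]
| move_R3 i b b' b'' of (b' == b) || (b' == b'') :
    local_move [:: (i, Cross b); (i.+1, Cross b'); (i, Cross b'')]
               [:: (i.+1, Cross b''); (i, Cross b'); (i.+1, Cross b)].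

Definition diagram_move (D D' : diagram) : Prop :=
  exists u v l r : seq slice,
    [/\ local_move l r, slices D = u ++ l ++ v & slices D' = u ++ r ++ v].

(* The equivalence relation generated by the moves: two diagrams are isotopic
   iff they represent the same oriented link. *)
Inductive isotopic : diagram -> diagram -> Prop :=
| isotopic_refl D : isotopic D D
| isotopic_move D D' : diagram_move D D' -> isotopic D D'
| isotopic_sym D D' : isotopic D D' -> isotopic D' D
| isotopic_trans D D' D'' :
    isotopic D D' -> isotopic D' D'' -> isotopic D D''.

Definition circle : diagram :=
  @Diagram [:: (0, Cup true); (0, Cap)]%N isT erefl.

(* ** Positive and negative crossings, skein triples *)

Definition slash_tangent (d : direction) : int * int :=
  if d then (1, 1) else (-1, -1).
Definition backslash_tangent (d : direction) : int * int :=
  if d then (-1, 1) else (1, -1).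

Definition det2 (v w : int * int) : int := v.1 * w.2 - v.2 * w.1.

(* Sign of a piece Cross b whose bottom left and bottom right ends have
   directions a and c: the strand "/" starts at the bottom left end. *)
Definition positive_crossing (a c : direction) (b : bool) : bool :=
  let sl := slash_tangent a in
  let bs := backslash_tangent c in
  let: (over, under) := if b then (sl, bs) else (bs, sl) in
  0 < det2 over under.

(* Orientation-consistent smoothing of that crossing: two vertical strands if
   the directions agree, and otherwise a maximum below a minimum; c is the
   direction of the top left end of the crossing. *)
Definition smoothing (i : nat) (a c : direction) : seq slice :=
  if a == c then [::] else [:: (i, Cap); (i, Cup c)].

Definition skein_triple (Dp Dm D0 : diagram) : Prop :=
  exists (u v : seq slice) (s : seq direction) (i : nat) (b : bool),
    let a := nth true s i in
    let c := nth true s i.+1 in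
    [/\ run [::] u = Some s,
        positive_crossing a c b,
        slices Dp = u ++ (i, Cross b) :: v,
        slices Dm = u ++ (i, Cross (~~ b)) :: v &
        slices D0 = u ++ smoothing i a c ++ v].

(* ** The HOMFLY polynomial *)

(* The field Q(y, z), in which Z[y^+-1, z^+-1] is the subring of the elements
   satisfying [laurent]. *)
Definition ratfun := {fraction {poly {poly int}}}.

Definition var_y : ratfun := FracField.tofrac 'X.
Definition var_z : ratfun := FracField.tofrac ('X%:P).

Definition laurent (f : ratfun) : Prop :=
  exists (p : {poly {poly int}}) (m : nat),
    f = FracField.tofrac p / (var_y * var_z) ^+ m.

(* The defining properties of L |-> P(L; y, z), as a function on diagrams. *)
Record is_HOMFLY (P : diagram -> ratfun) : Prop := IsHOMFLY {
  HOMFLY_laurent : forall D, laurent (P D);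
  HOMFLY_isotopy : forall D D', isotopic D D' -> P D = P D';
  HOMFLY_unknot : P circle = 1;
  HOMFLY_skein : forall Dp Dm D0, skein_triple Dp Dm D0 ->
    var_y * P Dp + var_y^-1 * P Dm = var_z * P D0 }.

(* ** Braids and their closures *)

(* Words in the Artin generators of the braid group on n strands: (i, true)
   stands for sigma_(i+1) and (i, false) for its inverse. *)
Definition braid_word (n : nat) := seq ('I_n.-1 * bool).

Definition braid_pow n (w : braid_word n) (k : nat) : braid_word n :=
  flatten (nseq k w).

Definition sigma1 : braid_word 3 := [:: (ord0, true)].
Definition sigma2 : braid_word 3 := [:: (ord_max, true)].

(* The braid is drawn upwards, all its strands oriented upwards (so that
   Cross true is a positive crossing), and is closed by arcs on its right. *)
Definition closure_slices (m : nat) (w : braid_word m.+1) : seq slice :=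
  [seq (i, Cup true) | i <- iota 0 m.+1] ++
  [seq (nat_of_ord l.1, Cross l.2) | l <- w] ++
  [seq (i, Cap) | i <- rev (iota 0 m.+1)].

Lemma run_cat s u v : run s (u ++ v) = obind (run^~ v) (run s u).
Proof. by elim: u s => [|x u IH] s //=; case: (step s x) => //= t. Qed.

Lemma run_cups k :
  run [::] [seq (i, Cup true) | i <- iota 0 k] =
    Some (nseq k true ++ nseq k false).
Proof.
elim: k => [|k IH] //; rewrite -addn1 iotaD map_cat run_cat IH /= add0n.
rewrite size_cat !size_nseq leq_addr take_size_cat ?drop_size_cat ?size_nseq //.
by rewrite nseqD -catA (addn1 k).
Qed.

Lemma run_caps k :
  run (nseq k true ++ nseq k false) [seq (i, Cap) | i <- rev (iota 0 k)] =
    Some [::].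
Proof.
elim: k => [|k IH] //; have -> : iota 0 k.+1 = iota 0 k ++ [:: k] by rewrite -addn1 iotaD.
have -> : nseq k.+1 true = nseq k true ++ [:: true] by rewrite -addn1 nseqD.
rewrite rev_cat -catA /=.
by rewrite take_size_cat ?drop_size_cat ?size_nseq.
Qed.

Lemma step_crossing i k b t : (i.+1 < k)%N ->
  step (nseq k true ++ t) (i, Cross b) = Some (nseq k true ++ t).
Proof.
move=> /subnKC <-; rewrite -addn2 -addnA nseqD -catA /=.
by rewrite take_size_cat ?drop_size_cat ?size_nseq.
Qed.

Lemma run_crossings m (w : braid_word m.+1) t :
  run (nseq m.+1 true ++ t) [seq (nat_of_ord l.1, Cross l.2) | l <- w] =
    Some (nseq m.+1 true ++ t).
Proof.
by elim: w => [|[i b] w IH] //; rewrite map_cons [run _ _]/run -/run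
  step_crossing ?ltnS.
Qed.

Lemma closure_closed m (w : braid_word m.+1) :
  run [::] (closure_slices w) = Some [::].
Proof.
by rewrite run_cat run_cups /obind /oapp run_cat run_crossings /obind /oapp
  run_caps.
Qed.

Definition braid_closure (m : nat) (w : braid_word m.+1) : diagram :=
  @Diagram (closure_slices w) isT (closure_closed w).

(* Main.v *)
Require Import Defs.
From mathcomp Require Import all_boot all_order all_algebra.
From mathcomp Require Import ring.

Set Implicit Arguments.
Unset Strict Implicit.
Unset Printing Implicit Defensive.

Import GRing.Theory.

(** The link invariant enters only through its values on closures of words in
    the braid generators. Weight each word by [y] to the power of its exponent
    sum, [g w = y ^ (exponent sum of w) * P (closure of w)]. The skein relation
    then loses its coefficients on the left:
    [g (u s v) + g (u s^-1 v) = z g (u v)],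
    and [g] still respects the cancellation [s s^-1 = 1] and the braid relation,
    which are Reidemeister moves of the closure and preserve the exponent sum
    ([homfly_hecke_form]). In other words [g] is a linear form on the Hecke
    algebra of [B_3], in which every generator satisfies [s + s^-1 = z].

    Let [A], [B] be the two generators, [C = A B] and [D = A B A = B A B].
    Expanding the inverses with [s^-1 = z - s] gives
    - ([hecke_product_inverse]) [C + C^-1 = z^2 - z (A + B) + A B + B A =: T];
      this is symmetric in [A] and [B], hence also equal to [B A + (B A)^-1];
    - ([hecke_half_twist]) [D + D^-1 = z T - z].
    The braid relation and [A^2 = z A - 1] give
    [C^2 = A B A B = A A B A = z D - B A], and in the same way
    [C^-2 = z D^-1 - (B A)^-1]. Adding these,
    [C^2 + C^-2 = z (D + D^-1) - T = (z^2 - 1) T - z^2], that is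
    [C^2 - (z^2 - 1) C + z^2 - (z^2 - 1) C^-1 + C^-2 = 0]
    ([hecke_coxeter_quartic]).
    Multiply on the left by [C^(n+2)] and on the right by [A], apply [g], and
    divide by the weight [y^(2n+9)] of [C^(n+4) A]: this is the recurrence. *)

Local Open Scope ring_scope.

(** * Linear forms on the Hecke algebra *)

(** On three strands the three conditions, together, say that the linear
    extension of [g] to combinations of words factors through the Hecke
    algebra, presented by the braid relation and [s + s^-1 = z]. *)
Record hecke_form (R : comNzRingType) (z : R) (m : nat)
    (g : braid_word m.+1 -> R) : Prop := HeckeForm {
  hecke_skein : forall u i v,
    g (u ++ (i, true) :: v) + g (u ++ (i, false) :: v) = z * g (u ++ v);
  hecke_cancel : forall u i b v,
    g (u ++ [:: (i, b), (i, ~~ b) & v]) = g (u ++ v);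
  hecke_braid : forall u (i j : 'I_m) b v, j = i.+1 :> nat ->
    g (u ++ [:: (i, b), (j, b), (i, b) & v]) =
    g (u ++ [:: (j, b), (i, b), (j, b) & v]) }.

(** Multiplication by fixed words acts on linear forms, so that identities
    need only be proved without surrounding words. *)
Lemma hecke_form_translate (R : comNzRingType) (z : R) m
    (g : braid_word m.+1 -> R) (l r : braid_word m.+1) :
  hecke_form z g -> hecke_form z (fun w => g (l ++ w ++ r)).
Proof.
move=> [gS gC gB]; split=> [u i v | u i b v | u i j b v ij];
  rewrite -!catA !(catA l u) /=; [exact: gS | exact: gC | exact: gB].
Qed.

Lemma hecke_inverse (R : comNzRingType) (z : R) m
    (g : braid_word m.+1 -> R) : hecke_form z g ->
  forall u i v, g (u ++ (i, false) :: v) = z * g (u ++ v) - g (u ++ (i, true) :: v).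
Proof. by move=> gP u i v; rewrite -(hecke_skein gP u i v) addrC addKr. Qed.

(** Multiplying [s + s^-1 = z] by [s] or by [s^-1]: both satisfy
    [x^2 = z x - 1]. *)
Lemma hecke_square (R : comNzRingType) (z : R) m
    (g : braid_word m.+1 -> R) : hecke_form z g ->
  forall i b v, g [:: (i, b), (i, b) & v] = z * g ((i, b) :: v) - g v.
Proof.
move=> gP i b v; have /= <- := hecke_cancel gP [::] i b v.
have /= <- := hecke_skein gP [:: (i, b)] i v.
by case: b; ring.
Qed.

(** * Two generators satisfying the braid relation *)

(** The value of a form on [T = z^2 - z (s_i + s_j) + s_i s_j + s_j s_i]. *)
Definition hecke_T (R : comNzRingType) (z : R) m (g : braid_word m.+1 -> R)
    (i j : 'I_m) : R :=
  z ^+ 2 * g [::] - z * (g [:: (i, true)] + g [:: (j, true)])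
  + g [:: (i, true); (j, true)] + g [:: (j, true); (i, true)].

Lemma hecke_TC (R : comNzRingType) (z : R) m (g : braid_word m.+1 -> R) i j :
  hecke_T z g i j = hecke_T z g j i.
Proof. by rewrite /hecke_T; ring. Qed.

Lemma hecke_product_inverse (R : comNzRingType) (z : R) m
    (g : braid_word m.+1 -> R) (i j : 'I_m) : hecke_form z g ->
  g [:: (i, true); (j, true)] + g [:: (j, false); (i, false)] = hecke_T z g i j.
Proof.
move=> gP; have V := hecke_inverse gP; rewrite /hecke_T.
have /= -> := V [::] j [:: (i, false)].
have /= -> := V [::] i [::].
have /= -> := V [:: (j, true)] i [::].
by ring.
Qed.

(** In [(z - B) (z - A) (z - B)] the square [B^2 = z B - 1] makes the result
    symmetric in the two generators. *)
Lemma hecke_half_twist (R : comNzRingType) (z : R) m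
    (g : braid_word m.+1 -> R) (i j : 'I_m) : hecke_form z g -> j = i.+1 :> nat ->
  g [:: (i, true); (j, true); (i, true)] +
  g [:: (j, false); (i, false); (j, false)] = z * hecke_T z g i j - z * g [::].
Proof.
move=> gP ij; have V := hecke_inverse gP; rewrite /hecke_T.
have /= -> := V [::] j [:: (i, false); (j, false)].
have /= -> := V [::] i [:: (j, false)].
have /= -> := V [:: (j, true)] i [:: (j, false)].
have /= -> := V [::] j [::].
have /= -> := V [:: (i, true)] j [::].
have /= -> := V [:: (j, true)] j [::].
have /= -> := V [:: (j, true); (i, true)] j [::].
have /= <- := hecke_braid gP [::] true [::] ij.
rewrite (hecke_square gP); ring.
Qed.

(** The braid relation turns [A B A B] into [A A B A] and [B^-1 A^-1 B^-1 A^-1]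
    into [B^-1 B^-1 A^-1 B^-1]; reducing the squares leaves half twists and the
    products [B A] and [A^-1 B^-1], whose sums are known in terms of [T]. *)
Lemma hecke_coxeter_quartic (R : comNzRingType) (z : R) m
    (g : braid_word m.+1 -> R) (i j : 'I_m) : hecke_form z g -> j = i.+1 :> nat ->
  let a := (i, true) in let b := (j, true) in
  let a' := (i, false) in let b' := (j, false) in
  g [:: a; b; a; b] - (z ^+ 2 - 1) * g [:: a; b] + z ^+ 2 * g [::]
    - (z ^+ 2 - 1) * g [:: b'; a'] + g [:: b'; a'; b'; a'] = 0.
Proof.
move=> gP ij /=.
have /= <- := hecke_braid gP [:: (i, true)] true [::] ij.
have /= -> := hecke_braid gP [:: (j, false)] false [::] ij.
rewrite !(hecke_square gP).
have T1 := hecke_product_inverse i j gP.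
have T2 := hecke_product_inverse j i gP.
have D := hecke_half_twist gP ij.
rewrite hecke_TC in T2.
move/(canRL (addKr _)): T1 => ->; move/(canRL (addKr _)): T2 => ->.
move/(canRL (addKr _)): D => ->.
ring.
Qed.

(** * The HOMFLY polynomial of closed braids *)

Definition braid_slices m (w : braid_word m.+1) : seq slice :=
  [seq (nat_of_ord l.1, Cross l.2) | l <- w].

Lemma closure_slices_context m (u l v : braid_word m.+1) :
  closure_slices (u ++ l ++ v) =
  ([seq (i, Cup true) | i <- iota 0 m.+1] ++ braid_slices u) ++
  braid_slices l ++
  (braid_slices v ++ [seq (i, Cap) | i <- rev (iota 0 m.+1)]).
Proof. by rewrite /closure_slices /braid_slices !map_cat !catA. Qed.

Lemma closure_local_move m (u l r v : braid_word m.+1) :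
  local_move (braid_slices l) (braid_slices r) ->
  isotopic (braid_closure (u ++ l ++ v)) (braid_closure (u ++ r ++ v)).
Proof.
move=> lr; apply: isotopic_move; do 4!eexists; split; first exact: lr.
  exact: closure_slices_context.
exact: closure_slices_context.
Qed.

(** All strands of the braid part point upwards, so the positive letter is a
    positive crossing and the oriented smoothing erases the letter. *)
Lemma closure_skein_triple m (u v : braid_word m.+1) i :
  skein_triple (braid_closure (u ++ (i, true) :: v))
    (braid_closure (u ++ (i, false) :: v)) (braid_closure (u ++ v)).
Proof.
exists ([seq (i, Cup true) | i <- iota 0 m.+1] ++ braid_slices u).
exists (braid_slices v ++ [seq (i, Cap) | i <- rev (iota 0 m.+1)]).
exists (nseq m.+1 true ++ nseq m.+1 false), i, true.
have im : (i < m)%N := ltn_ord i.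
rewrite !nth_cat !size_nseq !ltnS (ltnW im) im !nth_nseq !ltnS (ltnW im) im.
split=> //; last exact: (closure_slices_context u [::] v).
- by rewrite run_cat run_cups /= run_crossings.
- exact: (closure_slices_context u [:: (i, true)] v).
- exact: (closure_slices_context u [:: (i, false)] v).
Qed.

Definition braid_weight (F : fieldType) (y : F) m (w : braid_word m.+1) : F :=
  \prod_(l <- w) (if l.2 then y else y^-1).

Lemma var_y_neq0 : var_y != 0.
Proof. by rewrite tofrac_eq0 polyX_eq0. Qed.

(** The weight of [u s v] is [y] times that of [u v], and the weight of
    [u s^-1 v] is [y^-1] times it; these are the coefficients of the skein
    relation, which are thereby absorbed. *)
Lemma homfly_hecke_form (P : diagram -> ratfun) m : is_HOMFLY P ->
  hecke_form var_z
    (fun w : braid_word m.+1 => braid_weight var_y w * P (braid_closure w)).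
Proof.
move=> hP; have y0 := var_y_neq0; split=> [u i v | u i b v | u i j b v ij].
- have := HOMFLY_skein hP (closure_skein_triple u v i).
  rewrite /braid_weight !big_cat !big_cons /=.
  move: (\prod_(l <- u) _) (\prod_(l <- v) _) => p q S.
  by rewrite [RHS]mulrCA -S; ring.
- congr (_ * _).
    rewrite /braid_weight !big_cat !big_cons /=.
    by congr (_ * _); case: b; rewrite /= ?mulVKf ?mulKf.
  apply: (HOMFLY_isotopy hP).
  apply: (closure_local_move u (l := [:: (i, b); (i, ~~ b)]) (r := [::]) v).
  exact: move_R2.
- congr (_ * _).
    by rewrite /braid_weight !big_cat !big_cons.
  apply: (HOMFLY_isotopy hP).
  apply: (closure_local_move u (l := [:: (i, b); (j, b); (i, b)])
            (r := [:: (j, b); (i, b); (j, b)]) v).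
  by rewrite /braid_slices /= ij; apply: move_R3; rewrite eqxx.
Qed.

(** * The recurrence *)

Lemma braid_powS m (w : braid_word m.+1) k :
  braid_pow w k.+1 = braid_pow w k ++ w.
Proof.
by rewrite /braid_pow -[k.+1]addn1 nseqD flatten_cat /= cats0.
Qed.

Lemma braid_weight_coxeter_pow (F : fieldType) (y : F) k :
  braid_weight y (braid_pow (sigma1 ++ sigma2) k ++ sigma1) = y ^+ k.*2.+1.
Proof.
rewrite /braid_weight big_cat big_seq1 /= exprSr; congr (_ * _).
elim: k => [|k IH]; first by rewrite big_nil.
by rewrite braid_powS big_cat IH !big_cons big_nil /= doubleS !exprSr mulr1 mulrA.
Qed.

(** The first identity is [y^(2n+9)] times the second. *)
Lemma weighted_recurrence (F : fieldType) (y z : F) (a : nat -> F) n : y != 0 ->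
  let b k := y ^+ k.*2.+1 * a k in
  b n.+4 - (z ^+ 2 - 1) * b n.+3 + z ^+ 2 * b n.+2 - (z ^+ 2 - 1) * b n.+1 + b n = 0 ->
  a n.+4 - (y ^- 2 * z ^+ 2 - y ^- 2) * a n.+3 + y ^- 4 * z ^+ 2 * a n.+2
    - (y ^- 6 * z ^+ 2 - y ^- 6) * a n.+1 + y ^- 8 * a n = 0.
Proof.
move=> y0 b Q; apply: (mulfI (expf_neq0 n.+4.*2.+1 y0)); rewrite mulr0 -Q /b.
by rewrite !doubleS !exprS; field; rewrite y0.
Qed.

Theorem lemma25 (P : diagram -> ratfun) (hP : is_HOMFLY P) (n : nat) :
  let a (k : nat) := P (braid_closure (braid_pow (sigma1 ++ sigma2) k ++ sigma1)) in
  a n.+4 - (var_y ^- 2 * var_z ^+ 2 - var_y ^- 2) * a n.+3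
    + var_y ^- 4 * var_z ^+ 2 * a n.+2
    - (var_y ^- 6 * var_z ^+ 2 - var_y ^- 6) * a n.+1
    + var_y ^- 8 * a n = 0.
Proof.
move=> a; have gP := homfly_hecke_form 2 hP.
set g := (fun w => _) in gP; set c := sigma1 ++ sigma2.
have ga k : g (braid_pow c k ++ sigma1) = var_y ^+ k.*2.+1 * a k.
  by rewrite /g braid_weight_coxeter_pow.
pose c' : braid_word 3 := [:: (ord_max, false); (ord0, false)].
have cS k w : g (braid_pow c k ++ c ++ w) = g (braid_pow c k.+1 ++ w).
  by rewrite braid_powS catA.
have cV k w : g (braid_pow c k.+1 ++ c' ++ w) = g (braid_pow c k ++ w).
  rewrite -cS -[RHS](hecke_cancel gP _ ord0 true w).
  have := hecke_cancel gP (braid_pow c k ++ sigma1) ord_max true ((ord0, false) :: w).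
  by rewrite -!catA.
(* The identity for [C^2, C, 1, C^-1, C^-2] is used at exponent n + 2, so that
   only nonnegative powers of [C] remain after cancellation. *)
have : g (braid_pow c n.+2 ++ (c ++ c) ++ sigma1)
    - (var_z ^+ 2 - 1) * g (braid_pow c n.+2 ++ c ++ sigma1)
    + var_z ^+ 2 * g (braid_pow c n.+2 ++ sigma1)
    - (var_z ^+ 2 - 1) * g (braid_pow c n.+2 ++ c' ++ sigma1)
    + g (braid_pow c n.+2 ++ (c' ++ c') ++ sigma1) = 0.
  exact: (hecke_coxeter_quartic (i := ord0) (j := ord_max)
    (hecke_form_translate (braid_pow c n.+2) sigma1 gP) erefl).
rewrite -(catA c c) -(catA c' c') !cS !cV !ga.
exact: weighted_recurrence var_y_neq0.
Qed.
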